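(* Let $d\geq 2$ and $k\geq 1$ be integers. There exists no stationary $k$-dependent $3$-coloring of $\mathbb{Z}^d$.
   Context: Write $|\cdot|$ for the $1$-norm on $\mathbb{Z}^d$. A $q$-coloring of $\mathbb{Z}^d$ is a random element $X=(X_v)_{v\in\mathbb{Z}^d}$ of $\{1,\dots,q\}^{\mathbb{Z}^d}$ such that almost surely $X_u\neq X_v$ whenever $|u-v|=1$. A process $X=(X_v)_{v\in\mathbb{Z}^d}$ is $k$-dependent if $(X_v)_{v\in A}$ is independent of $(X_v)_{v\in B}$ for any subsets $A,B\subseteq\mathbb{Z}^d$ that satisfy $|u-v|>k$ for all $u\in A$ and $v\in B$. It is stationary if $(X_{v+u})_{v\in\mathbb{Z}^d}$ and $(X_v)_{v\in\mathbb{Z}^d}$ are equal in law for all $u\in\mathbb{Z}^d$. *)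

(* Defs.v *)
From mathcomp Require Export all_boot all_order all_algebra.
From mathcomp Require Export all_classical all_reals all_analysis.

Set Implicit Arguments.
Unset Strict Implicit.
Unset Printing Implicit Defensive.

Import Order.TTheory GRing.Theory Num.Theory.

Local Open Scope classical_set_scope.
Local Open Scope ring_scope.

Notation site d := 'rV[int]_d.

Definition norm1 (d : nat) (u : site d) : nat := (\sum_(i < d) `|u ord0 i|)%N.

(* The events {X_v \in S} for v \in A; the sigma-algebra they generate is the
   one generated by the family (X_v)_{v \in A}. *)
Definition coord_events (d : nat) (T : Type) (X : T -> site d -> nat)
    (A : set (site d)) : set (set T) :=
  \bigcup_(v in A) preimage_set_system setT (fun w => X w v) (@measurable _ nat).

(* Configurations nat^(Z^d) with the product sigma-algebra, nat being discrete.
   Colours are natural numbers; [is_coloring q] confines them to {1, .., q}. *)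
Notation config d :=
  (g_sigma_algebraType (@coord_events d (site d -> nat) id setT)).

Definition translate (d : nat) (u : site d) (x : config d) : config d :=
  fun v => x (v + u).

Section Processes.
Context (disp : measure_display) (T : measurableType disp) (R : realType).
Context (P : probability T R) (d : nat).

Definition is_coloring (q : nat) (X : {RV P >-> config d}) : Prop :=
  (forall w v, (1 <= X w v <= q)%N) /\
  {ae P, forall w, forall u v : site d, norm1 (u - v) = 1%N -> X w u <> X w v}.

Definition independent_on (X : {RV P >-> config d}) (A B : set (site d)) : Prop :=
  forall E F : set T, <<s coord_events X A >> E -> <<s coord_events X B >> F ->
    P (E `&` F) = (P E * P F)%E.

Definition k_dependent (k : nat) (X : {RV P >-> config d}) : Prop :=
  forall A B : set (site d),
    (forall u v, A u -> B v -> (k < norm1 (u - v))%N) -> independent_on X A B.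

(* Laws are compared on measurable sets only: the values of a measure outside
   the sigma-algebra carry no meaning. *)
Definition stationary (X : {RV P >-> config d}) : Prop :=
  forall (u : site d) (S : set (config d)), measurable S ->
    pushforward P (translate u \o X) S = pushforward P X S.

End Processes.

(* Main.v *)
Require Import Defs.
From mathcomp Require Import zify ring.

Set Implicit Arguments.
Unset Strict Implicit.
Unset Printing Implicit Defensive.
Import Order.TTheory GRing.Theory Num.Theory.

Local Open Scope classical_set_scope.
Local Open Scope ring_scope.

(** A proper colouring of Z^d by the residues mod 3 has a height function: the
    colour difference along an edge is +1 or -1 mod 3, and around a unit square
    four signs with sum divisible by 3 sum to 0, so the signs add up along
    paths consistently ([rise_rectangle]).  Only two axes i and j matter.  Let
    [rise] be the height difference between the ends of a segment.

    Opposite sides of a rectangle whose other side is longer than k are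
    independent with the same law.  Hence the bottom side can have its greatest
    possible rise M while the top side has its least possible rise m; the
    identity bottom - top = left - right then gives M - m <= M' - m', where m'
    and M' are the extreme rises of the vertical sides ([extreme_width_le]).
    Exchanging the roles of the axes, all long segments along either axis have
    one and the same width D = M - m, and a rectangle whose left side has rise
    M' and whose right side has rise m' must have a bottom side with rise
    exactly M ([columns_force]).

    Vertical segments at horizontal spacing a > k can be made to alternate
    between the extremes M' and m', so the rise over 2na can equal n (M_a + m_a)
    ([alternating_attained]).  The same length cut into pieces of length a + 1
    gives another possible value; as both lie in a window of width D whatever n
    is, (a + 1) (M_a + m_a) = a (M_(a+1) + m_(a+1)).  The widths being equal,
    M_a + m_a = 2 a (M_(a+1) - M_a).  A rise has the parity of the length, so
    M_(a+1) - M_a is odd, hence nonzero, and |M_a + m_a| >= 2 a; since a rise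
    over length a is at most a, this forces M_a = m_a ([extreme_rises_eq]).  Then
    the colours at the ends of a segment of length a > k determine each other,
    although they are independent: contradiction ([rise_not_constant]). *)

(** * Observables of a family of sites *)

Definition observable (T : Type) (G : set (set T)) (C : Type) (f : T -> C) :=
  forall S : set C, <<s G >> (f @^-1` S).

Lemma observable2 (T : pointedType) (G : set (set T)) (C D : countType)
    (E : Type) (f : T -> C) (g : T -> D) (h : C -> D -> E) :
  observable G f -> observable G g -> observable G (fun w => h (f w) (g w)).
Proof.
move=> mf mg S.
pose F (p : C * D) : set (g_sigma_algebraType G) :=
  if `[< S (h p.1 p.2) >] then f @^-1` [set p.1] `&` g @^-1` [set p.2] else set0.
suff -> : (fun w => h (f w) (g w)) @^-1` S = \bigcup_p F p.
  suff : measurable (\bigcup_p F p) by [].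
  apply: countable_bigcupT_measurable => [|p]; first exact: countableP.
  rewrite /F.
  case: ifP => _; last exact: measurable0.
  by apply: measurableI; [exact: mf | exact: mg].
apply/seteqP; split=> w /=.
  by move=> Sw; exists (f w, g w) => //; rewrite /F /= asboolT.
by case=> p _; rewrite /F; case: asboolP => // Sp [-> ->].
Qed.

Lemma observable_cst (T : Type) (G : set (set T)) (C : Type) (c : C) :
  observable G (fun _ => c).
Proof.
move=> S; have [Sc|nSc] := pselect (S c).
  rewrite (_ : _ @^-1` S = setT `\` set0).
    by apply: sigma_algebraCD; exact: sigma_algebra0.
  by apply/seteqP; split => // w _; split.
rewrite (_ : _ @^-1` S = set0); first exact: sigma_algebra0.
by apply/seteqP; split => // w /nSc.
Qed.

Lemma observable_coord (d : nat) (T : pointedType) (X : T -> site d -> nat)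
    (A : set (site d)) v : A v -> observable (coord_events X A) (X^~ v).
Proof.
move=> Av S; apply: sub_sigma_algebra; exists v => //.
by exists S => //=; rewrite setTI.
Qed.

Lemma coord_eventsS (d : nat) (T : Type) (X : T -> site d -> nat)
    (A B : set (site d)) : A `<=` B ->
  <<s coord_events X A >> `<=` <<s coord_events X B >>.
Proof.
move=> AB; apply: smallest_sub; first exact: smallest_sigma_algebra.
by move=> E [v /AB Bv Ev]; apply: sub_sigma_algebra; exists v.
Qed.

(** * Events of positive probability *)

Section PositiveProbability.
Context (disp : measure_display) (T : measurableType disp) (R : realType).
Context (P : probability T R) (d : nat).

Lemma coord_events_measurable (X : {RV P >-> config d}) A :
  <<s coord_events X A >> `<=` measurable.
Proof.
apply: smallest_sub => [|E [v Av [S mS <-]]]; first exact: sigma_algebra_measurable.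
have mS' : measurable ((fun x : config d => x v) @^-1` S).
  by apply: sub_sigma_algebra; exists v => //; exists S => //; rewrite setTI.
exact: (measurable_funPT X measurableT _ mS').
Qed.

Lemma ae_exists (Q : T -> Prop) E : measurable E -> P E <> 0%E ->
  {ae P, forall w, Q w} -> exists2 w, E w & Q w.
Proof.
move=> mE PE aeQ; apply: contrapT => nEQ; apply: PE.
apply: (measure_negligible mE); apply: negligibleS aeQ => w Ew /= Qw.
by apply: nEQ; exists w.
Qed.

Lemma ae_forall_countable (I : countType) (Q : I -> T -> Prop) :
  (forall i, {ae P, forall w, Q i w}) -> {ae P, forall w, forall i, Q i w}.
Proof.
move=> aeQ.
have aeQn n : {ae P, forall w, if unpickle n is Some i then Q i w else True}.
  by case: unpickle => [i|]; [exact: aeQ|exact: aeW].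
apply: negligibleS (ae_foralln aeQn) => w /= nQ Qn.
by apply: nQ => i; have := Qn (pickle i); rewrite pickleK.
Qed.

(** Almost surely, no observable of a countable family takes a value that it
    takes with probability zero: only countably many null events are excluded. *)
Lemma ae_charged (I C : countType) (Y : I -> T -> C) :
  (forall i c, measurable [set w | Y i w = c]) ->
  {ae P, forall w, forall i, P [set w' | Y i w' = Y i w] <> 0%E}.
Proof.
move=> mY; apply: ae_forall_countable => i.
suff: {ae P, forall w, forall c, P [set w' | Y i w' = c] = 0%E -> Y i w <> c}.
  by move=> H; apply: negligibleS H => w /= nQ QQ; apply: nQ => /QQ.
apply: ae_forall_countable => c.
case: (pselect (P [set w' | Y i w' = c] = 0%E)) => Pc; last exact: aeW.
exists [set w | Y i w = c]; split => // w /= nQ; apply: contrapT => nY.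
by apply: nQ.
Qed.
End PositiveProbability.

(** * The height function of a 3-colouring *)

(** The representative in {-1, 1} of y - x mod 3, for x and y distinct mod 3. *)
Definition turn (x y : nat) : int :=
  if (y == x.+1 %[mod 3])%N then 1 else -1.

(** Both sides are congruent to e - a mod 3 and lie in {-2, 0, 2}. *)
Lemma turn_square (a b c e : nat) :
  (1 <= a <= 3)%N -> (1 <= b <= 3)%N -> (1 <= c <= 3)%N -> (1 <= e <= 3)%N ->
  a <> b -> b <> e -> a <> c -> c <> e ->
  turn a b + turn b e = turn a c + turn c e.
Proof.
by case: a => [|[|[|[|a]]]] //; case: b => [|[|[|[|b]]]] //;
   case: c => [|[|[|[|c]]]] //; case: e => [|[|[|[|e]]]].
Qed.

Lemma turn_mod3 (a b : nat) :
  (1 <= a <= 3)%N -> (1 <= b <= 3)%N -> a <> b ->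
  exists z : int, b%:Z = a%:Z + turn a b + 3 * z.
Proof.
rewrite /turn => ? ? ?; case: eqP => h.
  by exists (if (b < a)%N then -1 else 0); case: ifP; lia.
by exists (if (b < a)%N then 0 else 1); case: ifP; lia.
Qed.

Lemma turnE a b : turn a b = 1 \/ turn a b = -1.
Proof. by rewrite /turn; case: ifP; [left|right]. Qed.

Definition axis (d : nat) (i : 'I_d) : site d := delta_mx ord0 i.

Lemma axisE d (i j : 'I_d) : axis i ord0 j = (j == i)%:R.
Proof. by rewrite mxE. Qed.

Lemma norm1_axis d (i : 'I_d) : norm1 (axis i) = 1%N.
Proof.
rewrite /norm1 (bigD1 i) //= big1 => [|j /negPf ji]; rewrite axisE ?eqxx ?ji //.
Qed.

Lemma norm1N d (u : site d) : norm1 (- u) = norm1 u.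
Proof. by apply: eq_bigr => i _; rewrite mxE abszN. Qed.

Lemma norm1_geB d (u v : site d) i :
  (absz (u ord0 i - v ord0 i)%R <= norm1 (u - v))%N.
Proof. by rewrite /norm1 (bigD1 i) //= !mxE leq_addr. Qed.

(** For a unit vector e, the height at v + n e minus the height at v. *)
Definition rise (d : nat) (x : site d -> nat) (e v : site d) (n : nat) : int :=
  \sum_(l < n) turn (x (v + e *+ l)) (x (v + e *+ l.+1)).

Definition proper3 (d : nat) (x : site d -> nat) : Prop :=
  (forall v, (1 <= x v <= 3)%N) /\
  (forall u v : site d, norm1 (u - v) = 1%N -> x u <> x v).

Section Rise.
Context (d : nat).
Implicit Types (x : site d -> nat) (e v u : site d).

Lemma riseS x e v n :
  rise x e v n.+1 = rise x e v n + turn (x (v + e *+ n)) (x (v + e *+ n.+1)).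
Proof. by rewrite /rise big_ord_recr. Qed.

Lemma rise0 x e v : rise x e v 0 = 0.
Proof. by rewrite /rise big_ord0. Qed.

Lemma rise_norm x e v n : `|rise x e v n| <= n%:Z.
Proof.
elim: n => [|n IH]; first by rewrite rise0.
rewrite riseS; have := turnE (x (v + e *+ n)) (x (v + e *+ n.+1)); lia.
Qed.

Lemma rise_parity x e v n : exists z, rise x e v n = n%:Z + 2 * z.
Proof.
elim: n => [|n [z IH]]; first by exists 0; rewrite rise0; ring.
rewrite riseS IH; have [-> | ->] := turnE (x (v + e *+ n)) (x (v + e *+ n.+1)).
  by exists z; lia.
by exists (z - 1); lia.
Qed.

Lemma rise_cat x e v m n :
  rise x e v (m + n) = rise x e v m + rise x e (v + e *+ m) n.
Proof.
elim: n => [|n IH]; first by rewrite addn0 rise0 addr0.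
by rewrite addnS !riseS IH -addrA -!addrA -!mulrnDr addnS.
Qed.

Lemma rise_translate x e v u n :
  rise x e (v + u) n = rise (fun w => x (w + u)) e v n.
Proof. by apply: eq_bigr => l _; congr (turn (x _) (x _)); rewrite addrAC. Qed.

Lemma proper3_step x v i : proper3 x -> x v <> x (v + axis i).
Proof.
by case=> _; apply; rewrite opprD addrA subrr sub0r norm1N norm1_axis.
Qed.

Lemma rise_mod3 x v i n : proper3 x ->
  exists z : int, (x (v + axis i *+ n))%:Z = (x v)%:Z + rise x (axis i) v n + 3 * z.
Proof.
move=> px; elim: n => [|n [z IH]].
  by exists 0; rewrite rise0 mulr0n !addr0.
have [z' Hz'] : exists z' : int,
    (x (v + axis i *+ n.+1))%:Z = (x (v + axis i *+ n))%:Z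
    + turn (x (v + axis i *+ n)) (x (v + axis i *+ n.+1)) + 3 * z'.
  by apply: turn_mod3; [exact: px.1|exact: px.1|]; rewrite mulrSr addrA; exact: proper3_step.
exists (z + z'); rewrite riseS; lia.
Qed.

(** Summing [turn_square] over the unit squares of an a by b rectangle. *)
Lemma rise_rectangle x v i j a b : proper3 x ->
  rise x (axis i) v a + rise x (axis j) (v + axis i *+ a) b =
  rise x (axis j) v b + rise x (axis i) (v + axis j *+ b) a.
Proof.
move=> px.
have column c u : turn (x u) (x (u + axis i)) + rise x (axis j) (u + axis i) c =
    rise x (axis j) u c + turn (x (u + axis j *+ c)) (x (u + axis j *+ c + axis i)).
  elim: c => [|c IH]; first by rewrite !rise0 mulr0n !addr0 add0r.
  rewrite !riseS addrA IH -!addrA; congr (_ + _).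
  have -> : u + (axis j *+ c + axis i) = u + axis j *+ c + axis i by rewrite addrA.
  have -> : u + (axis i + axis j *+ c) = u + axis j *+ c + axis i.
    by rewrite -addrA [X in _ + X]addrC.
  have -> : u + (axis i + axis j *+ c.+1) = u + axis j *+ c + axis i + axis j.
    by rewrite mulrSr -!addrA; congr (_ + _); rewrite addrCA.
  have -> : u + (axis j *+ c.+1 + axis i) = u + axis j *+ c + axis i + axis j.
    by rewrite mulrSr -!addrA; congr (_ + (_ + _)); rewrite addrC.
  have -> : u + axis j *+ c.+1 = u + axis j *+ c + axis j by rewrite mulrSr addrA.
  set t := u + axis j *+ c.
  apply: turn_square; try exact: px.1; try exact: proper3_step.
  by rewrite [t + _ + _]addrAC; exact: proper3_step.
elim: a => [|a IH]; first by rewrite !rise0 mulr0n !addr0 add0r.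
have := column b (v + axis i *+ a).
rewrite !riseS mulrSr !addrA [v + axis i *+ a + axis j *+ b]addrAC => colE.
by rewrite -[LHS]addrA colE [LHS]addrA IH.
Qed.
End Rise.

(** * Attained rises of a stationary k-dependent 3-colouring *)

Lemma observable_rise (d : nat) (T : pointedType) (X : T -> site d -> nat)
    (A : set (site d)) (e v : site d) (n : nat) :
  (forall l, (l <= n)%N -> A (v + e *+ l)) ->
  observable (coord_events X A) (fun w => rise (X w) e v n).
Proof.
elim: n => [|n IH] Ae.
  have -> : (fun w => rise (X w) e v 0) = (fun=> 0).
    by apply/funext => w; rewrite rise0.
  exact: observable_cst.
have -> : (fun w => rise (X w) e v n.+1) = (fun w => rise (X w) e v n +
    turn (X w (v + e *+ n)) (X w (v + e *+ n.+1))).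
  by apply/funext => w; rewrite riseS.
apply: (@observable2 _ _ _ _ _ _ _ +%R).
  by apply: IH => l ln; apply: Ae; exact: leqW.
apply: (@observable2 _ _ _ _ _ _ _ turn); apply: observable_coord; exact: Ae.
Qed.

Lemma int_max_exists (S : int -> Prop) (n : nat) (y : int) :
  S y -> (forall z, S z -> `|z| <= n%:Z) ->
  exists M, S M /\ forall z, S z -> z <= M.
Proof.
move=> Sy bS; pose p (l : nat) := `[< S (l%:Z - n%:Z) >].
have [l pl] : exists l, p l.
  exists (absz (y + n%:Z)); apply/asboolP.
  by have -> : (absz (y + n%:Z))%:Z - n%:Z = y by move: (bS _ Sy); lia.
have pub l' : p l' -> (l' <= 2 * n)%N by move=> /asboolP/bS; lia.
case: (ex_maxnP (ex_intro _ l pl) pub) => M /asboolP SM maxM.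
exists (M%:Z - n%:Z); split => // z Sz.
have : p (absz (z + n%:Z)).
  apply/asboolP.
  by have -> : (absz (z + n%:Z))%:Z - n%:Z = z by move: (bS _ Sz); lia.
by move=> /maxM; move: (bS _ Sz); lia.
Qed.

Section Coloring.
Context (disp : measure_display) (T : measurableType disp) (R : realType).
Context (P : probability T R) (d k : nat) (X : {RV P >-> config d}).
Context (Xcol : is_coloring 3 X) (Xdep : k_dependent k X) (Xsta : stationary X).

Lemma stationary_eq (C : Type) (f : (site d -> nat) -> C) u c :
  observable (coord_events id setT) f ->
  P [set w | f (fun v => X w (v + u)) = c] = P [set w | f (X w) = c].
Proof. by move=> mf; exact: (Xsta u (mf [set c])). Qed.

Definition attained (e : site d) n y := P [set w | rise (X w) e 0 n = y] <> 0%E.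

Lemma rise_stationary e v n y :
  P [set w | rise (X w) e v n = y] = P [set w | rise (X w) e 0 n = y].
Proof.
rewrite -(@stationary_eq _ (fun x => rise x e 0 n) v y); last exact: observable_rise.
by congr (P _); apply/seteqP; split => w /=; rewrite -rise_translate add0r.
Qed.

Lemma color_stationary v (c : nat) : P [set w | X w v = c] = P [set w | X w 0 = c].
Proof.
rewrite -(@stationary_eq _ (fun x => x 0) v c); last exact: observable_coord.
by congr (P _); apply/seteqP; split => w /=; rewrite add0r.
Qed.

(** Half-spaces at distance more than k are the only regions to which
    k-dependence is applied: every configuration below is split by a hyperplane
    orthogonal to an axis. *)
Lemma charged_independent i (c : int) E F :
  <<s coord_events X [set u : site d | u ord0 i + k%:Z < c] >> E ->
  <<s coord_events X [set u : site d | c <= u ord0 i] >> F ->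
  P E <> 0%E -> P F <> 0%E -> P (E `&` F) <> 0%E.
Proof.
move=> mE mF PE PF.
rewrite (Xdep _ mE mF); last first.
  move=> u v /= uc cv; apply: leq_trans (norm1_geB u v i); lia.
by move=> /eqP; rewrite mule_eq0 => /orP[] /eqP.
Qed.

(** Extreme rises only bound the rises almost surely; working at a typical
    point of a non-null event turns these bounds into plain inequalities. *)
Definition typical w := [/\ proper3 (X w),
  forall e v n, attained e n (rise (X w) e v n) &
  forall u v, P [set w' | X w' v = X w u] <> 0%E].

Lemma typical_exists E : measurable E -> P E <> 0%E -> exists2 w, E w & typical w.
Proof.
move=> mE PE; apply: (ae_exists mE PE).
have m1 : {ae P, forall w, forall u v, norm1 (u - v) = 1%N -> X w u <> X w v} := Xcol.2.
have m2 : {ae P, forall w, forall p : site d * site d * nat,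
    P [set w' | rise (X w') p.1.1 p.1.2 p.2 = rise (X w) p.1.1 p.1.2 p.2] <> 0%E}.
  apply: ae_charged => p y.
  apply: (@coord_events_measurable _ _ _ P d X setT).
  exact: (@observable_rise _ _ X _ _ _ _ _ [set y]).
have m3 : {ae P, forall w, forall u, P [set w' | X w' u = X w u] <> 0%E}.
  apply: ae_charged => u c.
  apply: (@coord_events_measurable _ _ _ P d X setT).
  exact: (@observable_coord _ _ X _ u _ [set c]).
apply: filterS3 m1 m2 m3 => w h1 h2 h3; split; first by split; [exact: Xcol.1|].
- by move=> e v n; have := h2 (e, v, n); rewrite /= rise_stationary.
- by move=> u v; have := h3 u; rewrite (color_stationary u) (color_stationary v).
Qed.

Definition extreme_rises e n (m M : int) := [/\ attained e n m, attained e n M &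
  forall y, attained e n y -> m <= y <= M].

Lemma attained_norm e n y : attained e n y -> `|y| <= n%:Z.
Proof.
move=> Sy; have [w [<-]] : [set w | rise (X w) e 0 n = y] !=set0; last exact: rise_norm.
by apply/set0P/eqP => S0; apply: Sy; rewrite S0 measure0.
Qed.

Lemma attained_parity e n y : attained e n y -> exists z, y = n%:Z + 2 * z.
Proof.
move=> Sy; have [w [<-]] : [set w | rise (X w) e 0 n = y] !=set0; last exact: rise_parity.
by apply/set0P/eqP => S0; apply: Sy; rewrite S0 measure0.
Qed.

Lemma extreme_rises_exist e n : exists m M, extreme_rises e n m M.
Proof.
have [|w _ [_ + _]] := @typical_exists setT measurableT.
  by rewrite probability_setT; apply/eqP; exact: onee_neq0.
move=> /(_ e 0 n) S0.
have [M [SM maxM]] := int_max_exists S0 (@attained_norm e n).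
have [||m [Sm maxm]] := @int_max_exists (fun y => attained e n (- y)) n
  (- rise (X w) e 0 n).
- by rewrite opprK.
- by move=> z /attained_norm; rewrite normrN.
exists (- m), M; split => // y Sy; rewrite maxM // lerNl maxm // opprK //.
Qed.

(** * Rigidity of rectangles *)

Lemma coord_line (v : site d) (i j : 'I_d) (l : nat) :
  (v + axis i *+ l) ord0 j = v ord0 j + (if j == i then l%:Z else 0) :> int.
Proof.
by rewrite mxE mulmxnE axisE; case: eqP => _; rewrite ?mul0rn // -natz.
Qed.

Lemma charged_rise e v n y : attained e n y ->
  P [set w | rise (X w) e v n = y] <> 0%E.
Proof. by rewrite rise_stationary. Qed.

(** Horizontal sides at height 0 and b > k are independent, so the bottom one
    can be extremal upwards and the top one downwards at the same time; the
    vertical sides make up for the difference. *)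
Lemma extreme_width_le (i j : 'I_d) a b m M m' M' : i != j -> (k < b)%N ->
  extreme_rises (axis i) a m M -> extreme_rises (axis j) b m' M' -> M - m <= M' - m'.
Proof.
move=> ij kb [Sm SM _] [_ _ bnd'].
pose bottom := [set w | rise (X w) (axis i) 0 a = M].
pose top := [set w | rise (X w) (axis i) (0 + axis j *+ b) a = m].
have mbottom : <<s coord_events X [set u : site d | u ord0 j + k%:Z < b%:Z] >> bottom.
  apply: (observable_rise (A := [set u : site d | u ord0 j + k%:Z < b%:Z]) _ [set M]).
  by move=> l _ /=; rewrite coord_line eq_sym (negPf ij) mxE; lia.
have mtop : <<s coord_events X [set u : site d | b%:Z <= u ord0 j] >> top.
  apply: (observable_rise (A := [set u : site d | b%:Z <= u ord0 j]) _ [set m]).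
  by move=> l _ /=; rewrite !coord_line eqxx eq_sym (negPf ij) mxE; lia.
have both := charged_independent mbottom mtop SM (charged_rise Sm).
have [|w [bot_w top_w] [proper_w att_w _]] := typical_exists _ both.
  by apply: measurableI; [apply: (coord_events_measurable mbottom)
                         |apply: (coord_events_measurable mtop)].
have := rise_rectangle 0 i j a b proper_w; rewrite bot_w top_w.
have /andP[_] := bnd' _ (att_w (axis j) 0 b).
have /andP[] := bnd' _ (att_w (axis j) (0 + axis i *+ a) b).
set V := rise _ _ 0 b; set V' := rise _ _ _ b; lia.
Qed.

(** Columns with opposite extreme rises make the bottom and top rises differ by
    M' - m' = M - m, the largest possible amount, so each of these is extremal. *)
Lemma columns_force w v (i j : 'I_d) a b m M m' M' : typical w ->
  extreme_rises (axis i) a m M -> extreme_rises (axis j) b m' M' -> M - m = M' - m' ->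
  (rise (X w) (axis j) v b = M' -> rise (X w) (axis j) (v + axis i *+ a) b = m' ->
   rise (X w) (axis i) v a = M) /\
  (rise (X w) (axis j) v b = m' -> rise (X w) (axis j) (v + axis i *+ a) b = M' ->
   rise (X w) (axis i) v a = m).
Proof.
move=> [proper_w att_w _] [_ _ bnd] _ widths.
have := rise_rectangle v i j a b proper_w.
have /andP[] := bnd _ (att_w (axis i) v a).
have /andP[] := bnd _ (att_w (axis i) (v + axis j *+ b) a).
set H := rise _ (axis i) v a; set H' := rise _ (axis i) (v + _) a.
set V := rise _ (axis j) v b; set V' := rise _ (axis j) (v + _) b.
by split=> colL colR; lia.
Qed.

Definition alternating (i j : 'I_d) a b (m M : int) n : set T :=
  [set w | forall l, (l < n)%N ->
    rise (X w) (axis j) (axis i *+ (l * a)) b = if odd l then m else M].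

(** The columns lie more than k apart, so each new one is independent of the
    previous ones; measurability with respect to a half-space is carried along
    the induction for that purpose. *)
Lemma alternating_charged (i j : 'I_d) a b m M n : i != j -> (k < a)%N ->
  extreme_rises (axis j) b m M ->
  <<s coord_events X [set u : site d | u ord0 i + k%:Z < (n * a)%:Z] >>
    (alternating i j a b m M n) /\ P (alternating i j a b m M n) <> 0%E.
Proof.
move=> ij ka [Sm SM _]; elim: n => [|n [mE PE]].
  have -> : alternating i j a b m M 0 = setT `\` set0.
    by apply/seteqP; split => // w _; split.
  split; first by apply: sigma_algebraCD; exact: sigma_algebra0.
  by rewrite setD0 probability_setT; apply/eqP; exact: onee_neq0.
pose y := if odd n then m else M.
pose column := [set w | rise (X w) (axis j) (axis i *+ (n * a)) b = y].
have Sy : attained (axis j) b y by rewrite /y; case: odd.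
have altS : alternating i j a b m M n.+1 = alternating i j a b m M n `&` column.
  apply/seteqP; split => w /= => [alt|[alt col] l].
    by split => [l ln|]; [apply: alt; exact: ltnW|exact: alt].
  by rewrite ltnS leq_eqVlt => /orP[/eqP ->|/alt].
have in_col A : (forall l, A (axis i *+ (n * a) + axis j *+ l)) ->
    <<s coord_events X A >> column.
  by move=> Al; apply: (observable_rise (A := A) _ [set y]) => l _; exact: Al.
have colE l : (axis i *+ (n * a) + axis j *+ l) ord0 i = (n * a)%:Z :> int.
  by rewrite -[axis i *+ _]add0r !coord_line eqxx (negPf ij) mxE; lia.
rewrite altS; split; last first.
  apply: (charged_independent mE _ PE (charged_rise Sy)).
  by apply: in_col => l /=; rewrite colE.
suff : measurable ((alternating i j a b m M n `&` column) : set (g_sigma_algebraType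
    (coord_events X [set u : site d | u ord0 i + k%:Z < (n.+1 * a)%:Z]))) by [].
apply: measurableI.
  by apply: coord_eventsS mE => u /=; lia.
by apply: in_col => l /=; rewrite colE; lia.
Qed.

(** By [columns_force], the pieces of length a between alternating columns
    alternately have rise M and m. *)
Lemma alternating_attained (i j : 'I_d) a b m M m' M' n : i != j -> (k < a)%N ->
  extreme_rises (axis i) a m M -> extreme_rises (axis j) b m' M' -> M - m = M' - m' ->
  attained (axis i) (n * (2 * a)) (n%:Z * (M + m)).
Proof.
move=> ij ka Sh Sv widths.
have [mE PE] := alternating_charged (n * 2).+1 ij ka Sv.
have [w alt typ_w] := typical_exists (coord_events_measurable mE) PE.
suff <- : rise (X w) (axis i) 0 (n * (2 * a)) = n%:Z * (M + m).
  by have [_ + _] := typ_w; apply.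
have : (n <= n)%N by [].
elim: {-2}n => [|q IH] qn; first by rewrite rise0 mul0r.
have pos1 : 0 + axis i *+ (q * (2 * a)) = axis i *+ (q * 2 * a) by rewrite add0r mulnA.
have pos2 : axis i *+ (q * 2 * a) + axis i *+ a = axis i *+ ((q * 2).+1 * a).
  by rewrite -mulrnDr mulSn addnC.
have pos3 : axis i *+ ((q * 2).+1 * a) + axis i *+ a = axis i *+ ((q * 2).+2 * a).
  by rewrite -mulrnDr [in RHS]mulSn addnC.
have -> : (q.+1 * (2 * a) = q * (2 * a) + (a + a))%N by lia.
rewrite !rise_cat IH; last exact: ltnW.
rewrite pos1 pos2.
have odd0 : odd (q * 2) = false by rewrite oddM andbF.
have := alt (q * 2)%N; have := alt (q * 2).+1; have := alt (q * 2).+2.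
rewrite /= odd0 /= => c2 c1 c0.
have [h1 _] := columns_force (axis i *+ (q * 2 * a)) typ_w Sh Sv widths.
have [_ h2] := columns_force (axis i *+ ((q * 2).+1 * a)) typ_w Sh Sv widths.
rewrite h1 ?pos2 ?c0 ?c1 ?h2 ?pos3 ?c1 ?c2 //; lia.
Qed.

(** * The contradiction *)

(** Two alternating patterns, with pieces of length a and a + 1, cover the same
    length; their rises differ by a bounded amount, so the average slopes
    (M_a + m_a) / 2a and (M_(a+1) + m_(a+1)) / 2(a+1) are equal.  Their common
    value is q, odd by parity, and only slopes +-1 are then possible. *)
Lemma extreme_rises_eq (i j : 'I_d) a m M m' M' : i != j -> a = k.+1 ->
  extreme_rises (axis i) a m M -> extreme_rises (axis j) a m' M' -> m = M.
Proof.
move=> ij aE Sa Sv.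
have ka : (k < a)%N by rewrite aE.
have kb : (k < a.+1)%N by rewrite aE.
have ji : j != i by rewrite eq_sym.
have [p [Q Sb]] := extreme_rises_exist (axis i) a.+1.
have wa : M - m = M' - m'.
  by apply/eqP; rewrite eq_le !(extreme_width_le _ _ Sa Sv, extreme_width_le _ _ Sv Sa).
have wb : Q - p = M' - m'.
  by apply/eqP; rewrite eq_le !(extreme_width_le _ _ Sb Sv, extreme_width_le _ _ Sv Sb).
(* both patterns cover the length 2 n a (a + 1) *)
have close (n : nat) : n%:Z * (a.+1%:Z * (M + m) - a%:Z * (Q + p)) <= M - m /\
    - (n%:Z * (a.+1%:Z * (M + m) - a%:Z * (Q + p))) <= M - m.
  have A1 := alternating_attained (n := (n * a.+1)%N) ij ka Sa Sv wa.
  have A2 := alternating_attained (n := (n * a)%N) ij kb Sb Sv wb.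
  have [r [s Sn]] := extreme_rises_exist (axis i) (n * a.+1 * (2 * a)).
  have := extreme_width_le ij ka Sn Sv.
  have Elen : (n * a * (2 * a.+1) = n * a.+1 * (2 * a))%N by lia.
  rewrite Elen in A2; case: Sn => _ _ bnd.
  have /andP[] := bnd _ A1; have /andP[] := bnd _ A2.
  rewrite !PoszM; nia.
have slopes : a.+1%:Z * (M + m) = a%:Z * (Q + p).
  have [] := close (absz (M - m)).+1; nia.
case: Sa => [Sm SM _]; case: Sb => [_ SQ _].
have [z Mz] := attained_parity SM.
have [z' Qz] := attained_parity SQ.
have := attained_norm SM; have := attained_norm Sm; rewrite !ler_norml.
have a0 : 0 < a%:Z by rewrite aE.
(* q is the difference of the greatest rises over lengths a + 1 and a *)
pose q := 1 + 2 * (z' - z).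
have mean : Q + p = (M + m) + 2 * q by rewrite /q; lia.
have slope : M + m = a%:Z * q * 2.
  by move: slopes; rewrite mean -addn1 PoszD; lia.
have [q_neg|q_pos] : q <= -1 \/ 1 <= q by rewrite /q; lia.
  have : a%:Z * q <= a%:Z * -1 by rewrite ler_pM2l.
  by move=> aq /andP[h1 h2] /andP[h3 h4]; lia.
have : a%:Z * 1 <= a%:Z * q by rewrite ler_pM2l.
by move=> aq /andP[h1 h2] /andP[h3 h4]; lia.
Qed.

(** If the rise over a length a > k were deterministic, then the colour at one
    end of such a segment would determine the colour at the other end, which is
    independent of it; so all sites would have the same colour. *)
Lemma rise_not_constant (i : 'I_d) a m : (k < a)%N -> ~ extreme_rises (axis i) a m m.
Proof.
move=> ka [_ _ bnd].
have [|w0 _ [[_ proper0] _ charged0]] := @typical_exists setT measurableT.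
  by rewrite probability_setT; apply/eqP; exact: onee_neq0.
(* The colours of w0 at 0 and at u occur together at the two ends of one
   segment of length a, by stationarity and independence. *)
have residue u : exists z : int, (X w0 u)%:Z = (X w0 0)%:Z + m + 3 * z.
  pose near_end := [set w | X w 0 = X w0 0].
  pose far_end := [set w | X w (0 + axis i *+ a) = X w0 u].
  have mnear : <<s coord_events X [set u : site d | u ord0 i + k%:Z < a%:Z] >> near_end.
    apply: (observable_coord (A := [set u : site d | u ord0 i + k%:Z < a%:Z]) _ [set X w0 0]).
    by rewrite /= mxE; lia.
  have mfar : <<s coord_events X [set u : site d | a%:Z <= u ord0 i] >> far_end.
    apply: (observable_coord (A := [set u : site d | a%:Z <= u ord0 i]) _ [set X w0 u]).
    by rewrite /= coord_line eqxx mxE; lia.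
  have both := charged_independent mnear mfar (charged0 _ _) (charged0 _ _).
  have [|w [lw rw] [pw att _]] := typical_exists _ both.
    by apply: measurableI; [apply: (coord_events_measurable mnear)
                           |apply: (coord_events_measurable mfar)].
  have [z] := rise_mod3 0 i a pw; rewrite lw rw => ->; exists z.
  by have := bnd _ (att (axis i) 0 a); rewrite -eq_le => /eqP <-.
have [z1 e1] := residue 0; have [z2 e2] := residue (axis i).
have := proper0 (axis i) 0; rewrite subr0 norm1_axis => /(_ erefl); apply.
have := Xcol.1 w0 0; have := Xcol.1 w0 (axis i); lia.
Qed.
End Coloring.

Theorem corollary25 (d k : nat) (hd : (2 <= d)%N) (hk : (1 <= k)%N)
    (R : realType) (disp : measure_display) (T : measurableType disp)
    (P : probability T R) :
  ~ exists X : {RV P >-> config d},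
      [/\ is_coloring 3 X, k_dependent k X & stationary X].
Proof.
move=> [X [Xcol Xdep Xsta]].
pose i := Ordinal (ltnW hd); pose j := Ordinal hd.
have ij : i != j by [].
have [m [M Sa]] := extreme_rises_exist Xcol Xsta (axis i) k.+1.
have [m' [M' Sv]] := extreme_rises_exist Xcol Xsta (axis j) k.+1.
have eq_mM := extreme_rises_eq Xcol Xdep Xsta ij erefl Sa Sv.
by move: Sa; rewrite eq_mM; exact: (rise_not_constant Xcol Xdep Xsta (ltnSn k)).
Qed.
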